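(* In the multi-hop VAoI network described in the context, where node $0$ uses the randomized stationary, uniform, or threshold update policy, the average VAoI at the destination node $N+1$ is \[ \bar\Delta_{N+1}=\bar\Delta_1+p_g\sum_{i=1}^N\frac1{\rho_i}, \] where $\bar\Delta_j$ denotes the long-run average VAoI at node $j$.
   Context: Time is slotted. A source generates a new version in each slot independently with probability $p_g\in(0,1)$, and its version index $V_S(t)$ increases by one at the start of the slot following each generation. Nodes $0,1,\dots,N+1$ form a line; node $0$ always holds the current source version, node $N+1$ is the destination, and nodes $1,\dots,N$ are relays. Each node stores only the latest version it has received. Link $i$ (from node $i$ to node $i+1$) delivers a transmission successfully with probability $\rho_i$, independently across slots and links, with $\rho_0=p_s\in(0,1)$. Each relay node $i\ge1$ transmits its stored version in every slot, so that $V_{i+1}(t+1)=V_i(t)$ if the transmission on link $i$ at slot $t$ succeeds and $V_{i+1}(t+1)=V_{i+1}(t)$ otherwise. The VAoI at node $j$ is $\Delta_j(t)=V_S(t)-V_j(t)$. Node $0$ decides in each slot whether to transmit ($a(t)=1$) or not to node $1$ via one of: the randomized stationary policy (i.i.d. $a(t)\sim$ Bernoulli$(\alpha)$, $0<\alpha\le1$); the uniform policy ($a(t)=1$ iff $t\in\{0,D,2D,\dots\}$ for an integer $D\ge1$); or the threshold policy ($a(t)=1$ iff $\Delta_1(t)\ge\Delta_T$). The long-run average VAoI at node $j$ is $\bar\Delta_j=\lim_{t\to\infty}\mathbb{E}[\Delta_j(t)]$ (equivalently the long-run time average of $\mathbb{E}[\Delta_j(t)]$). *)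

(* Defs.v *)
From HB Require Import structures.
From mathcomp Require Import all_boot all_order all_algebra.
From mathcomp Require Import all_classical all_reals all_analysis.
Set Implicit Arguments. Unset Strict Implicit. Unset Printing Implicit Defensive.
Import Order.TTheory GRing.Theory Num.Theory.
Local Open Scope ring_scope.

Inductive policy (R : Type) :=
| Randomized of R     (* i.i.d. a(t) ~ Bernoulli(alpha) *)
| Uniform of nat      (* a(t) = 1 iff D divides t *)
| Threshold of nat.   (* a(t) = 1 iff Delta_1(t) >= Delta_T *)

Definition policy_ok (R : realType) (pol : policy R) : Prop :=
  match pol with
  | Randomized a => 0 < a <= 1
  | Uniform D => (0 < D)%N
  | Threshold _ => True
  end.

Definition bern (R : realType) (p : R) (b : bool) : R := if b then p else 1 - p.

(* Probability that the randomized coin of node 0 shows 1; for the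
   deterministic policies the coin is unused and taken to be 1 a.s. *)
Definition coin_prob (R : realType) (pol : policy R) : R :=
  match pol with Randomized a => a | _ => 1 end.

(* Randomness of one slot: (generation bit, policy coin, success bits of
   links 0..N). *)
Definition slot (N : nat) : finType :=
  (bool * bool * {ffun 'I_N.+1 -> bool})%type.

Definition slot_default (N : nat) : slot N := (false, false, [ffun => false]).

Definition slot_weight (R : realType) (N : nat) (pg : R) (rho : nat -> R)
  (pol : policy R) (x : slot N) : R :=
  bern pg x.1.1 * bern (coin_prob pol) x.1.2 *
  \prod_(i < N.+1) bern (rho i) (x.2 i).

(* System state: source version and stored versions of nodes j >= 1. *)
Record state := State { vS : nat; vnode : nat -> nat }.

Definition version (st : state) (j : nat) : nat :=
  if j == 0%N then vS st else vnode st j.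

Definition decide (R : Type) (pol : policy R) (t : nat) (coin : bool)
  (st : state) : bool :=
  match pol with
  | Randomized _ => coin
  | Uniform D => (D %| t)%N
  | Threshold T => (vnode st 1 + T <= vS st)%N   (* Delta_1(t) >= T *)
  end.

Definition step (R : Type) (N : nat) (pol : policy R) (t : nat) (x : slot N)
  (st : state) : state :=
  let a := decide pol t x.1.2 st in
  State (vS st + x.1.1)
    (fun j => if (1 <= j <= N.+1)%N then
                if x.2 (inord j.-1) && ((j.-1 == 0%N) ==> a)
                then version st j.-1 else vnode st j
              else vnode st j).

Definition init_state : state := State 0 (fun _ => 0%N).

Fixpoint state_at (R : Type) (N : nat) (pol : policy R) (w : nat -> slot N)
  (t : nat) : state :=
  match t with
  | 0 => init_state
  | t'.+1 => step pol t' (w t') (state_at pol w t')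
  end.

Definition vaoi (R : realType) (st : state) (j : nat) : R :=
  (vS st)%:R - (version st j)%:R.

Definition extend (N t : nat) (w : {ffun 'I_t -> slot N}) (s : nat) : slot N :=
  match insub s with Some i => w i | None => slot_default N end.

(* E[Delta_j(t)]: exact expectation over the (finitely many) random bits
   of slots 0..t-1, each slot having independent Bernoulli components. *)
Definition exp_vaoi (R : realType) (N : nat) (pg : R) (rho : nat -> R)
  (pol : policy R) (j t : nat) : R :=
  \sum_(w : {ffun 'I_t -> slot N})
    (\prod_(s < t) slot_weight pg rho pol (w s)) *
    vaoi R (state_at pol (extend w) t) j.

Definition avg_vaoi (R : realType) (N : nat) (pg : R) (rho : nat -> R)
  (pol : policy R) (j T : nat) : R :=
  (T.+1)%:R^-1 * \sum_(t < T.+1) exp_vaoi N pg rho pol j t.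

(* Main.v *)
Require Import Defs.
From HB Require Import structures.
From mathcomp Require Import all_boot all_order all_algebra.
From mathcomp Require Import all_classical all_reals all_analysis.
From mathcomp Require Import ring lra.
Import Order.TTheory GRing.Theory Num.Theory.
Import numFieldNormedType.Exports.
Local Open Scope classical_set_scope.
Local Open Scope ring_scope.

(* Write e_j(t) = E[Delta_j(t)]. Conditioning on the last slot, a relay satisfies
   e_{j+1}(t+1) = pg + rho_j e_j(t) + (1 - rho_j) e_{j+1}(t), so e_{j+1} is bounded
   when e_j is, and e_{j+1} - e_j - pg / rho_j is the increment of a bounded sequence;
   its time average therefore vanishes. For node 1 the same argument is run with an
   explicit solution u of the Poisson equation u(t+1) - u(t) = e_1(t) - L: a multiple
   of e_1 for the randomized policy, an affine function of e_1 whose coefficients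
   depend on t mod D for the uniform policy, and E[h(Delta_1(t))] with h quadratic
   below the threshold and affine above it for the threshold policy. *)

(** * Time averages and bounded increments *)

(** The sum telescopes to [u T.+1 - u 0], of size at most [B + B], and is divided by [T.+1]. *)
Lemma cvg_mean_increment0 (R : realType) (u : nat -> R) (B : R) :
  (forall t, `|u t| <= B) ->
  (fun T => T.+1%:R^-1 * \sum_(t < T.+1) (u t.+1 - u t)) @ \oo --> (0 : R).
Proof.
move=> uB; apply/norm_cvg0P.
apply: (@squeeze_cvgr _ _ _ _ (cst 0) (fun T => harmonic T * (B + B))); last 2 first.
- exact: cvg_cst.
- by rewrite -[X in _ --> X](mul0r (B + B)); apply: cvgMl; apply: cvg_harmonic.
near=> T; apply/andP; split; first exact: normr_ge0.
rewrite -(big_mkord xpredT (fun t => u t.+1 - u t)) telescope_sumr //.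
rewrite normrM gtr0_norm ?invr_gt0// ler_pM2l ?invr_gt0//.
by rewrite (le_trans (ler_normB _ _))// lerD.
Unshelve. all: by end_near. Qed.

Lemma cvg_mean_shift (R : realType) (d e u : nat -> R) (B c L : R) :
  (forall t, `|u t| <= B) ->
  (forall t, e t = d t + c + (u t.+1 - u t)) ->
  (fun T => T.+1%:R^-1 * \sum_(t < T.+1) d t) @ \oo --> L ->
  (fun T => T.+1%:R^-1 * \sum_(t < T.+1) e t) @ \oo --> L + c.
Proof.
move=> uB ed dL.
have -> : (fun T => T.+1%:R^-1 * \sum_(t < T.+1) e t) =
  (fun T => T.+1%:R^-1 * \sum_(t < T.+1) d t + c +
     T.+1%:R^-1 * \sum_(t < T.+1) (u t.+1 - u t)).
  apply/funext => T; under eq_bigr do rewrite ed; rewrite 2!big_split /=.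
  rewrite sumr_const card_ord !mulrDr -[c *+ _]mulr_natl mulKf ?pnatr_eq0 //.
rewrite -[X in _ --> X]addr0; apply: cvgD; last exact: cvg_mean_increment0 uB.
by apply: cvgD => //; exact: cvg_cst.
Qed.

(** * Expectations and conditioning on the last slot *)

Section Network.
Set Implicit Arguments.
Unset Strict Implicit.
Variables (R : realType) (N : nat) (pg : R) (rho : nat -> R) (pol : policy R).

(** [exp_vaoi] with an arbitrary state function in place of the age; the threshold policy needs
    nonlinear ones. *)
Definition state_expect (t : nat) (F : state -> R) : R :=
  \sum_(w : {ffun 'I_t -> slot N})
    (\prod_(s < t) slot_weight pg rho pol (w s)) *
    F (state_at pol (extend w) t).

Definition slot_expect (G : slot N -> R) : R :=
  \sum_(x : slot N) slot_weight pg rho pol x * G x.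

Lemma eq_state_at (w w' : nat -> slot N) (t : nat) :
  (forall s, (s < t)%N -> w s = w' s) -> state_at pol w t = state_at pol w' t.
Proof.
elim: t => //= t IH ww'; rewrite ww'// IH// => s st.
by rewrite ww'// ltnW.
Qed.

Lemma extend_ord (t : nat) (w : {ffun 'I_t -> slot N}) (s : 'I_t) :
  extend w s = w s.
Proof. by rewrite /extend valK. Qed.

(** A word of [t.+1] slots is a word of [t] slots followed by one more; the weight factors
    accordingly, and the state at time [t] depends on the first [t] slots only. *)
Lemma state_expectS (t : nat) (F : state -> R) :
  state_expect t.+1 F =
  state_expect t (fun st => slot_expect (fun x => F (step pol t x st))).
Proof.
pose snoc (p : {ffun 'I_t -> slot N} * slot N) : {ffun 'I_t.+1 -> slot N} :=
  [ffun i => if insub (val i) is Some k then p.1 k else p.2].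
pose unsnoc (w : {ffun 'I_t.+1 -> slot N}) :=
  ([ffun k : 'I_t => w (widen_ord (leqnSn t) k)], w ord_max).
have snoc_lt p (k : 'I_t) : snoc p (widen_ord (leqnSn t) k) = p.1 k.
  by rewrite ffunE /= valK.
have snoc_max p : snoc p ord_max = p.2 by rewrite ffunE insubF ?ltnn.
have snocK : cancel snoc unsnoc.
  move=> [w x]; rewrite /unsnoc snoc_max; congr pair.
  by apply/ffunP => k; rewrite ffunE snoc_lt.
have unsnocK : cancel unsnoc snoc.
  move=> w; apply/ffunP => i; rewrite ffunE; case: insubP => [k _ ki|].
    by rewrite ffunE; congr (w _); apply: val_inj.
  rewrite -leqNgt => ti; congr (w _); apply: val_inj; apply/eqP.
  by rewrite eqn_leq ti -ltnS ltn_ord.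
rewrite /state_expect (reindex snoc) /=; last by exists unsnoc => ? _.
rewrite -(pair_bigA _ (fun w x => (\prod_(s < t.+1) slot_weight pg rho pol
  (snoc (w, x) s)) * F (step pol t (extend (snoc (w, x)) t)
    (state_at pol (extend (snoc (w, x))) t)))) /=.
apply: eq_bigr => w _; rewrite /slot_expect mulr_sumr; apply: eq_bigr => x _.
rewrite big_ord_recr /= snoc_max mulrA /=; congr (_ * _ * F _).
  by apply: eq_bigr => s _; rewrite snoc_lt.
rewrite (extend_ord (snoc (w, x)) ord_max) snoc_max; congr step.
apply: eq_state_at => s st.
rewrite (extend_ord (snoc (w, x)) (widen_ord (leqnSn t) (Ordinal st))).
by rewrite snoc_lt (extend_ord w (Ordinal st)).
Qed.

(** On such states ages are nonnegative, so the truncated subtraction in [age1] is exact. *)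
Definition causal (st : state) := forall j, (vnode st j <= vS st)%N.

Lemma causal_version (st : state) (j : nat) :
  causal st -> (version st j <= vS st)%N.
Proof. by rewrite /version => cst; case: ifP => // _. Qed.

Lemma causal_step (t : nat) (x : slot N) (st : state) :
  causal st -> causal (step pol t x st).
Proof.
move=> cst j /=; apply: leq_trans (leq_addr _ _).
by do 2?[case: ifP => // _]; exact: causal_version.
Qed.

Lemma causal_state_at (w : nat -> slot N) (t : nat) :
  causal (state_at pol w t).
Proof. by elim: t => //= t IH; exact: causal_step. Qed.

Lemma eq_state_expect (t : nat) (F G : state -> R) :
  (forall st, causal st -> F st = G st) -> state_expect t F = state_expect t G.
Proof.
move=> FG; apply: eq_bigr => w _; rewrite FG//; exact: causal_state_at.
Qed.

Lemma state_expectD (t : nat) (F G : state -> R) :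
  state_expect t (fun st => F st + G st) = state_expect t F + state_expect t G.
Proof. by rewrite -big_split; apply: eq_bigr => w _; rewrite mulrDr. Qed.

Lemma state_expectZ (t : nat) (a : R) (F : state -> R) :
  state_expect t (fun st => a * F st) = a * state_expect t F.
Proof. by rewrite mulr_sumr; apply: eq_bigr => w _; rewrite mulrCA. Qed.

Lemma sum_bern (p : R) : \sum_(b : bool) bern p b = 1.
Proof. by rewrite big_bool /bern /= addrC subrK. Qed.

(** The update of a node involves a single link; every other link sums out to a factor 1. *)
Lemma slot_expect_marginal (i : 'I_N.+1) (G : bool -> bool -> bool -> R) :
  slot_expect (fun x => G x.1.1 x.1.2 (x.2 i)) =
  \sum_g \sum_c \sum_b
    bern pg g * bern (coin_prob pol) c * bern (rho i) b * G g c b.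
Proof.
rewrite /slot_expect -(pair_bigA _ (fun p y => slot_weight pg rho pol (p, y) *
  G p.1 p.2 (y i))) -(pair_bigA _ (fun g c => \sum_y slot_weight pg rho pol
  (g, c, y) * G g c (y i))) /=.
apply: eq_bigr => g _; apply: eq_bigr => c _; rewrite /slot_weight /=.
under eq_bigr do rewrite -mulrA; under [RHS]eq_bigr do rewrite -mulrA.
rewrite -!mulr_sumr; congr (_ * _).
(* Moving [G] into the factor of link [i] makes the summand a product over links, so that sum and
   product can be exchanged. *)
transitivity (\sum_(y : {ffun 'I_N.+1 -> bool}) \prod_(k < N.+1)
  (bern (rho k) (y k) * (if k == i then G g c (y k) else 1))).
  apply: eq_bigr => y _; rewrite big_split /= -big_mkcond /=.
  by rewrite big_pred1_eq.
rewrite -(bigA_distr_bigA (fun (k : 'I_N.+1) b =>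
  bern (rho k) b * (if k == i then G g c b else 1))) (bigD1 i) //= eqxx.
rewrite [X in _ * X]big1 ?mulr1// => k /negbTE ->.
by under eq_bigr do rewrite mulr1; exact: sum_bern.
Qed.

Lemma state_expect_cst (t : nat) (a : R) : state_expect t (fun=> a) = a.
Proof.
elim: t => [|t IH].
  rewrite /state_expect (big_pred1 [ffun=> slot_default N]); last first.
    by move=> w; apply/esym/eqP/ffunP => -[].
  by rewrite big_ord0 mul1r.
rewrite state_expectS -[RHS]IH; apply: eq_state_expect => st _.
rewrite (slot_expect_marginal ord0 (fun _ _ _ => a)) !big_bool /bern /=; ring.
Qed.

(** * Ages after one slot *)

(* Probability that node 0 transmits, averaged over its own coin. *)
Definition send_prob (t : nat) (st : state) : R :=
  match pol with Randomized a => a | _ => (decide pol t true st)%:R end.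

Definition age1 (st : state) : nat := vS st - vnode st 1.

Lemma vaoi_age1 (st : state) : causal st -> vaoi R st 1 = (age1 st)%:R.
Proof. by move=> cst; rewrite /vaoi /version /= -natrB. Qed.

(** A delivery hands over the version held before the slot's generation takes effect, so the age
    restarts at the generation bit, not always at 0; otherwise that bit is added to the old age. *)
Lemma slot_expect_age1 (t : nat) (st : state) (h : nat -> R) : causal st ->
  slot_expect (fun x => h (age1 (step pol t x st))) =
  let q := rho 0 * send_prob t st in
  q * (pg * h 1%N + (1 - pg) * h 0%N) +
  (1 - q) * (pg * h (age1 st).+1 + (1 - pg) * h (age1 st)).
Proof.
move=> cst.
transitivity (slot_expect (fun x => let: g := x.1.1 in let: c := x.1.2 in
  let: b := x.2 ord0 in
  h (if b && decide pol t c st then g : nat else (age1 st + g)%N))).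
  apply: eq_bigr => x _; congr (_ * h _); rewrite /age1 /=.
  have -> : inord 0 = ord0 :> 'I_N.+1 by apply: val_inj; rewrite /= inordK.
  case: ifP => _; first by rewrite /version /= addKn.
  by rewrite addnBAC// cst.
rewrite (slot_expect_marginal ord0 (fun g c b =>
  h (if b && decide pol t c st then g : nat else (age1 st + g)%N))).
rewrite !big_bool /bern /send_prob /coin_prob /decide /= addn0 addn1.
case: pol => [a|D|T] /=; first ring.
- by case: (D %| t)%N => /=; ring.
- by case: (_ <= _)%N => /=; ring.
Qed.

Lemma slot_expect_relay (t j : nat) (st : state) : (1 <= j <= N)%N ->
  slot_expect (fun x => vaoi R (step pol t x st) j.+1) =
  pg + rho j * vaoi R st j + (1 - rho j) * vaoi R st j.+1.
Proof.
move=> /andP[j1 jN].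
have jN1 : (j < N.+1)%N by rewrite ltnS.
have j0 : (j == 0)%N = false by rewrite eqn0Ngt j1.
transitivity (slot_expect (fun x => let: g := x.1.1 in
  let: b := x.2 (Ordinal jN1) in
  (g : nat)%:R + (if b then vaoi R st j else vaoi R st j.+1))).
  apply: eq_bigr => x _; congr (_ * _); rewrite /vaoi /= /version /= jN1 j0 /=.
  have -> : inord j = Ordinal jN1 by apply: val_inj; rewrite /= inordK.
  by rewrite natrD andbT; case: ifP => _; rewrite ?/version ?j0; ring.
rewrite (slot_expect_marginal (Ordinal jN1) (fun g _ b =>
  (g : nat)%:R + (if b then vaoi R st j else vaoi R st j.+1))).
by rewrite !big_bool /bern /=; ring.
Qed.


(** * Recurrences for the expected ages *)

Lemma exp_vaoiE (j t : nat) :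
  exp_vaoi N pg rho pol j t = state_expect t (fun st => vaoi R st j).
Proof. by []. Qed.

Lemma exp_vaoi1E (t : nat) :
  exp_vaoi N pg rho pol 1 t = state_expect t (fun st => (age1 st)%:R).
Proof.
by rewrite exp_vaoiE; apply: eq_state_expect => st cst; rewrite vaoi_age1.
Qed.

Lemma exp_vaoi0 (j : nat) : exp_vaoi N pg rho pol j 0 = 0.
Proof.
rewrite /exp_vaoi big1 // => w _; rewrite /vaoi /version /=.
by rewrite if_same subrr mulr0.
Qed.

Lemma state_expect_age1S (t : nat) (h : nat -> R) :
  state_expect t.+1 (fun st => h (age1 st)) =
  state_expect t (fun st => let q := rho 0 * send_prob t st in
    q * (pg * h 1%N + (1 - pg) * h 0%N) +
    (1 - q) * (pg * h (age1 st).+1 + (1 - pg) * h (age1 st))).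
Proof.
by rewrite state_expectS; apply: eq_state_expect => st; exact: slot_expect_age1.
Qed.

(** [send_prob] stays inside the expectation because the threshold policy makes it depend on the
    age. *)
Lemma exp_vaoi1S (t : nat) :
  exp_vaoi N pg rho pol 1 t.+1 =
  pg + state_expect t (fun st => (1 - rho 0 * send_prob t st) * (age1 st)%:R).
Proof.
rewrite exp_vaoi1E (state_expect_age1S t (fun x => x%:R)).
rewrite -[pg in RHS](state_expect_cst t) -state_expectD.
by apply: eq_state_expect => st _ /=; rewrite -natr1; ring.
Qed.

Lemma exp_vaoi_relayS (t j : nat) : (1 <= j <= N)%N ->
  exp_vaoi N pg rho pol j.+1 t.+1 =
  pg + rho j * exp_vaoi N pg rho pol j t +
  (1 - rho j) * exp_vaoi N pg rho pol j.+1 t.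
Proof.
move=> jN; rewrite !exp_vaoiE state_expectS.
rewrite -[pg in RHS](state_expect_cst t) -!state_expectZ -!state_expectD.
by apply: eq_state_expect => st _; rewrite slot_expect_relay.
Qed.

(** * Positivity and uniform bounds *)

Hypothesis pg01 : 0 < pg < 1.
Hypothesis rho0_01 : 0 < rho 0 < 1.
Hypothesis rho01 : forall i, (1 <= i <= N)%N -> 0 < rho i <= 1.
Hypothesis pol_ok : policy_ok pol.

Lemma bern_ge0 (p : R) (b : bool) : 0 <= p <= 1 -> 0 <= bern p b.
Proof. by rewrite /bern; case: b => /andP[]; lra. Qed.

Lemma slot_weight_ge0 (x : slot N) : 0 <= slot_weight pg rho pol x.
Proof.
apply: mulr_ge0; first apply: mulr_ge0.
- by apply: bern_ge0; case/andP: pg01; lra.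
- apply: bern_ge0; move: pol_ok; rewrite /policy_ok /coin_prob.
  by case: pol => [a|D|T] ?; lra.
- apply: prodr_ge0 => i _; apply: bern_ge0.
  case: (posnP i) => [->|i0]; first by case/andP: rho0_01; lra.
  have : 0 < rho i <= 1 by apply: rho01; rewrite i0 -ltnS ltn_ord.
  by move=> ?; lra.
Qed.

Lemma le_state_expect (t : nat) (F G : state -> R) :
  (forall st, causal st -> F st <= G st) -> state_expect t F <= state_expect t G.
Proof.
move=> FG; apply: ler_sum => w _; apply: ler_wpM2l.
  by apply: prodr_ge0 => s _; exact: slot_weight_ge0.
by apply: FG; exact: causal_state_at.
Qed.

Lemma exp_vaoi_ge0 (j t : nat) : 0 <= exp_vaoi N pg rho pol j t.
Proof.
rewrite -(state_expect_cst t 0) exp_vaoiE; apply: le_state_expect => st cst.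
by rewrite /vaoi subr_ge0 ler_nat causal_version.
Qed.

(** [a / r] is the fixed point of the monotone map [x |-> a + (1 - r) * x], and the sequence starts
    below it. *)
Lemma le_affine_recurrence (e : nat -> R) (a r : R) :
  0 <= a -> 0 < r <= 1 -> e 0%N = 0 ->
  (forall t, e t.+1 <= a + (1 - r) * e t) -> forall t, e t <= a / r.
Proof.
move=> a0 /andP[r0 r1] e0 eS; elim=> [|t IH].
  by rewrite e0 divr_ge0 // ltW.
apply: le_trans (eS t) _.
have -> : a / r = a + (1 - r) * (a / r) by field; rewrite gt_eqF.
by rewrite lerD2l ler_wpM2l // subr_ge0.
Qed.

(** * Node 1 under the three policies *)

Lemma node1_from_poisson (u : nat -> R) (B C L : R) :
  (forall t, exp_vaoi N pg rho pol 1 t <= B) -> (forall t, `|u t| <= C) ->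
  (forall t, u t.+1 - u t = exp_vaoi N pg rho pol 1 t - L) ->
  exists L B, (forall t, exp_vaoi N pg rho pol 1 t <= B) /\
    avg_vaoi N pg rho pol 1 @ \oo --> (L : R).
Proof.
move=> eB uC uS; exists L, B; split => //.
rewrite -[X in _ --> X]add0r.
apply: (@cvg_mean_shift _ (fun=> 0) _ u C) => // [t|].
  by rewrite uS add0r addrC subrK.
by under eq_fun do rewrite big1 // mulr0; exact: cvg_cst.
Qed.

Lemma node1_randomized (a : R) : pol = Randomized a ->
  exists L B, (forall t, exp_vaoi N pg rho pol 1 t <= B) /\
    avg_vaoi N pg rho pol 1 @ \oo --> (L : R).
Proof.
have /andP[pg0 pg1] := pg01; move=> pola.
have a01 : 0 < a <= 1 by move: pol_ok; rewrite pola.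
set r := rho 0 * a.
have r01 : 0 < r <= 1.
  have /andP[q0 q1] := rho0_01; have /andP[a0 a1] := a01.
  by rewrite mulr_gt0 //= mulr_ile1// ltW.
have eS t : exp_vaoi N pg rho pol 1 t.+1 =
    pg + (1 - r) * exp_vaoi N pg rho pol 1 t.
  by rewrite exp_vaoi1S exp_vaoi1E -state_expectZ /send_prob pola.
have eB t : exp_vaoi N pg rho pol 1 t <= pg / r.
  apply: le_affine_recurrence => //; last 2 first.
  - exact: exp_vaoi0.
  - by move=> s; rewrite eS.
  - by lra.
have r0 : r != 0 by rewrite gt_eqF; lra.
(* The age increment is [pg - r * e_1(t)]; dividing it by [- r] gives the Poisson equation with
   [L = pg / r]. *)
apply: (@node1_from_poisson (fun t => - exp_vaoi N pg rho pol 1 t / r)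
  (pg / r) (pg / r / r) (pg / r)) => // t; last by rewrite eS; field.
have rV0 : 0 <= r^-1 by rewrite invr_ge0; lra.
rewrite normrM normrN !ger0_norm // ?exp_vaoi_ge0 //.
by rewrite ler_wpM2r.
Qed.

Lemma node1_uniform (D : nat) : pol = Defs.Uniform R D ->
  exists L B, (forall t, exp_vaoi N pg rho pol 1 t <= B) /\
    avg_vaoi N pg rho pol 1 @ \oo --> (L : R).
Proof.
have /andP[pg0 pg1] := pg01; move=> polD.
have D0 : (0 < D)%N by move: pol_ok; rewrite polD.
set q := rho 0; have /andP[q0 q1] : 0 < q < 1 by [].
have qN0 : q != 0 by rewrite gt_eqF.
have DN0 : D%:R != 0 :> R by rewrite pnatr_eq0 -lt0n.
set e := exp_vaoi N pg rho pol 1.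
have eS t : e t.+1 = pg + (1 - q * (D %| t)%:R) * e t.
  by rewrite /e exp_vaoi1S exp_vaoi1E -state_expectZ /send_prob polD.
(* [(phase t).+1] slots separate [t] from the last transmission slot before it. *)
pose phase t := ((t + D.-1) %% D)%N.
have phaseS t : phase t.+1 = (t %% D)%N.
  by rewrite /phase addSnnS prednK // modnDr.
have phase_dvd t : (D %| t)%N -> phase t = D.-1.
  by case/dvdnP=> k ->; rewrite /phase modnMDl modn_small // prednK.
have phase_ndvd t : ~~ (D %| t)%N -> (t %% D)%N = (phase t).+1.
  move=> Dt; rewrite -[in LHS](modnDr t D) -{1}(prednK D0) addnS modnS.
  by rewrite -addnS prednK // dvdn_addl // (negbTE Dt).
have phase_lt t : (phase t < D)%N by rewrite ltn_mod.
(* Over one period the mean just before a transmission maps as [m |-> (1 - q) * m + D * pg], with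
   fixed point [pg * D / q]; the bound follows this periodic orbit, rising by [pg] per slot up to
   that value. *)
have eB t : e t <= pg * (D%:R / q - D%:R + (phase t).+1%:R).
  elim: t => [|t IH].
    rewrite [e 0%N]exp_vaoi0 phase_dvd // prednK // subrK.
    by rewrite mulr_ge0 ?divr_ge0 //; lra.
  rewrite eS phaseS; have [Dt|Dt] := boolP (D %| t)%N.
    move: IH; rewrite (eqP Dt) phase_dvd // prednK // subrK mulr1 => IH.
    apply: (@le_trans _ _ (pg + (1 - q) * (pg * (D%:R / q)))).
      by rewrite lerD2l ler_wpM2l //; lra.
    by rewrite le_eqVlt; apply/orP; left; apply/eqP; field.
  by rewrite phase_ndvd // mulr0 subr0 mul1r -natr1 addrA mulrDr mulr1
    [pg + _]addrC lerD2r.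
have eB' t : e t <= pg * (D%:R / q).
  apply: le_trans (eB t) _; rewrite ler_wpM2l; [by []|by lra|].
  by have : (phase t).+1%:R <= D%:R :> R by [rewrite ler_nat]; lra.
(* [b] collects the constant terms of the Poisson equation within a period; [L] is the value for
   which they cancel over a full period. *)
pose L := - (pg / D%:R) * \sum_(k < D) (k%:R - D%:R / q).
pose b (s : nat) := \sum_(k < s.+1) (- L - pg * (k%:R - D%:R / q)).
have b_last : b D.-1 = 0.
  rewrite /b prednK // sumrB sumr_const card_ord -mulr_sumr -[(- L) *+ _]mulr_natl /L.
  by field.
(* The coefficient of [e t] gains 1 per slot; the offset [- D / q] makes its reset at a
   transmission, combined with the contraction [1 - q], also leave coefficient 1. *)
pose u t := ((phase t)%:R - D%:R / q) * e t + b (phase t).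
pose C := \sum_(s < D) `|b s|.
apply: (@node1_from_poisson u (pg * (D%:R / q))
  ((D%:R + D%:R / q) * (pg * (D%:R / q)) + C) L) => // t.
  have Dq : 0 <= D%:R / q by rewrite divr_ge0 // ltW.
  apply: le_trans (ler_normD _ _) _; rewrite lerD //.
    rewrite normrM ler_pM // ?(ger0_norm (exp_vaoi_ge0 _ _)) //.
    apply: le_trans (ler_normB _ _) _.
    by rewrite (ger0_norm Dq) lerD2r ger0_norm // ler_nat ltnW.
  by rewrite /C (bigD1 (Ordinal (phase_lt t))) //= lerDl sumr_ge0.
rewrite /u -/(e t) eS phaseS; have [Dt|Dt] := boolP (D %| t)%N.
  rewrite (eqP Dt) phase_dvd // b_last /b big_ord1 /=.
  by rewrite -subn1 natrB //; field.
rewrite phase_ndvd // /b big_ord_recr /= -natr1; ring.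
Qed.

(** Here the recurrence for the mean does not close, so the Poisson equation is solved pointwise in
    the age and then averaged. *)
Lemma node1_threshold (T : nat) : pol = Threshold R T ->
  exists L B, (forall t, exp_vaoi N pg rho pol 1 t <= B) /\
    avg_vaoi N pg rho pol 1 @ \oo --> (L : R).
Proof.
move=> polT; have /andP[pg0 pg1] := pg01.
set q := rho 0; have /andP[q0 q1] : 0 < q < 1 by [].
have qN0 : q != 0 by rewrite gt_eqF.
have pgN0 : pg != 0 by rewrite gt_eqF.
set e := exp_vaoi N pg rho pol 1.
have sendE t st : causal st -> send_prob t st = (T <= age1 st)%N%:R.
  by move=> cst; rewrite /send_prob polT /= /age1 leq_subRL // addnC.
(* Below the threshold nothing contracts, but there [x <= q * T + (1 - q) * x], so an extra constant
   [q * T] restores an affine recurrence. *)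
have eB t : e t <= (pg + q * T%:R) / q.
  apply: le_affine_recurrence => //; last 2 first.
  - exact: exp_vaoi0.
  - move=> {}t; rewrite /e exp_vaoi1S exp_vaoi1E -addrA lerD2l.
    rewrite -(state_expect_cst t (q * T%:R)) -state_expectZ -state_expectD.
    apply: le_state_expect => st cst; rewrite sendE // -/q.
    have [Tx|xT] := leqP; first by rewrite mulr1 lerDr mulr_ge0 // ltW.
    have : (age1 st)%:R <= T%:R :> R by rewrite ler_nat ltnW.
    by rewrite mulr0 subr0 mul1r => /(ler_wpM2l (ltW q0)); lra.
  - by rewrite addr_ge0 ?mulr_ge0 // ltW.
  - by rewrite q0 ltW.
pose K : R := \sum_(y < T) y%:R.
(* For [T > 0], [Z] is the mean number of slots between successful transmissions of node 0, and the
   numerator of [L] is the mean sum of ages over them. For [T = 0] the quotient is [pg / q]. *)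
pose Z := T%:R / pg + (1 - q) / q.
have Z0 : Z != 0.
  by rewrite gt_eqF // ltr_wpDl ?divr_ge0 ?divr_gt0 ?subr_gt0 // ltW.
pose L := (K / pg + T%:R / q + (1 - q) * pg / q ^+ 2) / Z.
(* Obtained by matching constants in the Poisson equation above the threshold, where a reset
   contributes [pg * h 1 = - L]. *)
pose beta := ((1 - q) * L - (1 - q) * pg / q) / q.
(* Below the threshold the age only grows; above it, the Poisson equation has
   an affine solution. [L] is what makes the two pieces agree at [T]. *)
pose h (x : nat) :=
  if (x <= T)%N then \sum_(y < x) ((y%:R - L) / pg) else - x%:R / q + beta.
have h0 : h 0%N = 0 by rewrite /h big_ord0.
have h_lt x : (x < T)%N -> h x.+1 = h x + (x%:R - L) / pg.
  by move=> xT; rewrite /h xT (ltnW xT) big_ord_recr.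
have LZ : L * Z = K / pg + T%:R / q + (1 - q) * pg / q ^+ 2 by rewrite divfK.
have h_ge x : (T <= x)%N -> h x = - x%:R / q + beta.
  rewrite leq_eqVlt => /predU1P[<-|Tx]; last by rewrite /h leqNgt Tx.
  rewrite /h leqnn -mulr_suml sumrB sumr_const card_ord -/K -[L *+ _]mulr_natl.
  have -> : K = pg * (L * Z - T%:R / q - (1 - q) * pg / q ^+ 2).
    by rewrite LZ; field; rewrite qN0.
  by rewrite /beta /Z; field; rewrite qN0.
(* For [T = 0] age 0 already lies on the affine piece, so [h 0 = 0] gives [beta = 0], hence
   [L = pg / q]. *)
have h1 : pg * h 1%N = - L.
  have [T0|T0] := posnP T; last by rewrite h_lt // h0; field.
  have := h_ge 0%N; rewrite T0 h0 => /(_ isT) /esym.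
  rewrite oppr0 mul0r add0r => b0; rewrite h_ge ?T0 // b0.
  have : (1 - q) * (L - pg / q) = 0.
    by move/(congr1 (fun z => z * q)): b0; rewrite divfK // mul0r => <-; field.
  move/eqP; rewrite mulf_eq0 gt_eqF ?subr_gt0 //= subr_eq0 => /eqP ->.
  by field.
pose u t := state_expect t (fun st => h (age1 st)).
(* [h] grows at most linearly, so the bound on the mean age bounds [u]. *)
pose C := \sum_(x < T.+1) `|h x| + `|beta|.
have hC x : `|h x| <= C + q^-1 * x%:R.
  have qx : 0 <= q^-1 * x%:R by rewrite mulr_ge0 ?invr_ge0 // ltW.
  have [xT|Tx] := leqP x T.
    rewrite -ltnS in xT; rewrite /C (bigD1 (Ordinal xT)) //=.
    by rewrite -!addrA lerDl !addr_ge0 // sumr_ge0.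
  rewrite h_ge ?(ltnW Tx) //; apply: le_trans (ler_normD _ _) _.
  rewrite mulNr normrN mulrC (ger0_norm qx) addrC lerD2r lerDr.
  exact: sumr_ge0.
apply: (@node1_from_poisson u ((pg + q * T%:R) / q)
  (C + q^-1 * ((pg + q * T%:R) / q)) L) => // t.
  have uB : state_expect t (fun st => C + q^-1 * (age1 st)%:R) <=
      C + q^-1 * ((pg + q * T%:R) / q).
    rewrite state_expectD state_expect_cst state_expectZ -exp_vaoi1E lerD2l.
    by rewrite ler_wpM2l // invr_ge0 ltW.
  rewrite ler_norml; apply/andP; split; last first.
    apply: le_trans uB; apply: le_state_expect => st _.
    exact: le_trans (ler_norm _) (hC _).
  rewrite lerNl; apply: le_trans uB; rewrite -mulN1r -state_expectZ.
  apply: le_state_expect => st _; rewrite mulN1r.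
  by rewrite (le_trans _ (hC _)) // -normrN ler_norm.
rewrite /u state_expect_age1S exp_vaoi1E.
have -> : - L = state_expect t (fun=> - L) by rewrite state_expect_cst.
apply/eqP; rewrite subr_eq -!state_expectD; apply/eqP.
apply: eq_state_expect => st cst /=.
rewrite sendE // h0 h1 mulr0 addr0 -/q.
have [Tx|xT] := leqP.
  by rewrite !h_ge ?(leqW Tx) // /beta -natr1 !mulr1; field.
by rewrite h_lt // !mulr0; field.
Qed.

Lemma node1_average :
  exists L B, (forall t, exp_vaoi N pg rho pol 1 t <= B) /\
    avg_vaoi N pg rho pol 1 @ \oo --> (L : R).
Proof.
case Epol : pol => [a|D|T]; rewrite -Epol.
- exact: node1_randomized Epol.
- exact: node1_uniform Epol.
- exact: node1_threshold Epol.
Qed.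

(** * Induction along the relays *)

(** Boundedness is carried through the induction because the correction sequence at each relay is a
    multiple of its own expected age. *)
Lemma relay_average (L B : R) (j : nat) : (j <= N)%N ->
  (forall t, exp_vaoi N pg rho pol 1 t <= B) ->
  avg_vaoi N pg rho pol 1 @ \oo --> L ->
  (exists B', forall t, exp_vaoi N pg rho pol j.+1 t <= B') /\
  avg_vaoi N pg rho pol j.+1 @ \oo -->
    L + pg * \sum_(1 <= i < j.+1) (rho i)^-1.
Proof.
have /andP[pg0 pg1] := pg01; move=> + eB eL; elim: j => [|j IH] jN.
  by split; [exists B | rewrite big_geq // mulr0 addr0].
have [[B' eB'] eL'] := IH (ltnW jN).
set r := rho j.+1; have r01 : 0 < r <= 1 by exact: rho01.
have /andP[r0 r1] := r01.
have rN0 : r != 0 by rewrite gt_eqF.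
have eS t : exp_vaoi N pg rho pol j.+2 t.+1 =
    pg + r * exp_vaoi N pg rho pol j.+1 t +
    (1 - r) * exp_vaoi N pg rho pol j.+2 t by exact: exp_vaoi_relayS.
have B'0 : 0 <= B' by exact: le_trans (exp_vaoi_ge0 j.+1 0) (eB' 0%N).
have eB2 t : exp_vaoi N pg rho pol j.+2 t <= (pg + r * B') / r.
  apply: le_affine_recurrence => //; last 2 first.
  - exact: exp_vaoi0.
  - by move=> s; rewrite eS lerD2r lerD2l ler_wpM2l // ltW.
  - by rewrite addr_ge0 ?mulr_ge0 ?(ltW r0) //; lra.
split; first by exists ((pg + r * B') / r).
rewrite big_nat_recr //= mulrDr addrA -/r.
(* Solving the relay recurrence for the current age gives the preceding age plus [pg / r] minus the
   increment divided by [r]. *)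
apply: (@cvg_mean_shift _ (exp_vaoi N pg rho pol j.+1) _
  (fun t => - exp_vaoi N pg rho pol j.+2 t / r) ((pg + r * B') / r / r)) => // t.
- have rV0 : 0 <= r^-1 by rewrite invr_ge0 ltW.
  by rewrite normrM normrN !ger0_norm ?exp_vaoi_ge0 // ler_wpM2r.
- by rewrite eS; field.
Qed.

End Network.

Theorem theorem2 (R : realType) (N : nat) (pg : R) (rho : nat -> R)
  (pol : policy R) :
  0 < pg < 1 -> 0 < rho 0%N < 1 ->
  (forall i, (1 <= i <= N)%N -> 0 < rho i <= 1) ->
  policy_ok pol ->
  exists L : R,
    avg_vaoi N pg rho pol 1 @ \oo --> L /\
    avg_vaoi N pg rho pol N.+1 @ \oo -->
      L + pg * \sum_(1 <= i < N.+1) (rho i)^-1.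
Proof.
move=> hpg hrho0 hrho hpol.
have [L [B [eB eL]]] := node1_average hpg hrho0 hrho hpol.
exists L; split=> //.
by have [] := relay_average hpg hrho0 hrho hpol (leqnn N) eB eL.
Qed.
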